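(* Let $N_{\mathbf y}, N_{\mathbf x}, N_{\mathbf b}$ be positive integers with $N_{\mathbf b} < N_{\mathbf x}$. Consider the linear model $\mathbf{y} = \mathbf{H}\mathbf{x} + \mathbf{n}$, where $\mathbf{y}\in\mathbb{C}^{N_{\mathbf y}}$ is the measurement vector, $\mathbf{H}\in\mathbb{C}^{N_{\mathbf y}\times N_{\mathbf x}}$ is a known matrix, $\mathbf{x}\in\mathbb{C}^{N_{\mathbf x}}$ is a deterministic unknown parameter vector, and $\mathbf{n}\in\mathbb{C}^{N_{\mathbf y}}$ is a zero mean random noise vector with known positive definite covariance matrix $\mathbf{C}_{\mathbf{nn}}$ (the distribution of $\mathbf n$ is otherwise arbitrary). Suppose that $\mathbf{x}$ fulfills the linear constraints $\mathbf{A}\mathbf{x}=\mathbf{b}$, where $\mathbf{A}\in\mathbb{C}^{N_{\mathbf b}\times N_{\mathbf x}}$ has full row rank and $\mathbf{b}\in\mathbb{C}^{N_{\mathbf b}}$. Put $\mathbf{P}=\mathbf{H}^H\mathbf{C}_{\mathbf{nn}}^{-1}\mathbf{H}$. (1) If $N_{\mathbf y}\ge N_{\mathbf x}$ and $\mathbf{H}$ has full column rank, then the constrained BLUE (the estimator that minimizes the variances of the elements of $\hat{\mathbf x}_{\mathrm{CB}}$ such that $\mathbf{A}\hat{\mathbf x}_{\mathrm{CB}}=\mathbf{b}$; see context) is given by $$\hat{\mathbf x}_{\mathrm{CB}} = \left(\mathbf{I}-\mathbf{P}^{-1}\mathbf{A}^H\left(\mathbf{A}\mathbf{P}^{-1}\mathbf{A}^H\right)^{-1}\mathbf{A}\right)\mathbf{P}^{-1}\mathbf{H}^H\mathbf{C}_{\mathbf{nn}}^{-1}\mathbf{y}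 + \mathbf{P}^{-1}\mathbf{A}^H\left(\mathbf{A}\mathbf{P}^{-1}\mathbf{A}^H\right)^{-1}\mathbf{b},$$ and its covariance matrix is $$\mathbf{C}_{\hat{\mathbf x}\hat{\mathbf x},\mathrm{CB}} = \mathbf{P}^{-1}-\mathbf{P}^{-1}\mathbf{A}^H\left(\mathbf{A}\mathbf{P}^{-1}\mathbf{A}^H\right)^{-1}\mathbf{A}\mathbf{P}^{-1}.$$ (2) If $N_{\mathbf y}\ge N_{\mathbf x}$ does not hold, let $N_0=N_{\mathbf x}-N_{\mathbf b}$ and let $\mathbf{N}\in\mathbb{C}^{N_{\mathbf x}\times N_0}$ be a matrix whose columns are linearly independent basis vectors spanning the nullspace of $\mathbf{A}$. If $\mathbf{H}\mathbf{N}$ has full column rank (implying $N_{\mathbf y}\ge N_0$), then the constrained BLUE fulfilling $\mathbf{A}\hat{\mathbf x}_{\mathrm{CB}}=\mathbf{b}$ is given by $$\hat{\mathbf x}_{\mathrm{CB}} = \mathbf{N}\left(\mathbf{N}^H\mathbf{P}\mathbf{N}\right)^{-1}\mathbf{N}^H\mathbf{H}^H\mathbf{C}_{\mathbf{nn}}^{-1}\left(\mathbf{y}-\mathbf{H}\mathbf{x}_p\right)+\mathbf{x}_p,$$ where $\mathbf{x}_p\in\mathbb{C}^{N_{\mathbf x}}$ is an arbitrary particular solution of $\mathbf{A}\mathbf{x}_p=\mathbf{b}$, and its covariance matrix is $$\mathbf{C}_{\hat{\mathbf x}\hat{\mathbf x},\mathrm{CB}} = \mathbf{N}\left(\mathb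f{N}^H\mathbf{P}\mathbf{N}\right)^{-1}\mathbf{N}^H.$$
   Context: $(\cdot)^H$ denotes conjugate transposition and $\mathbf{I}$ the identity matrix of appropriate size. The noise covariance matrix is $\mathbf{C}_{\mathbf{nn}}=E[\mathbf{n}\mathbf{n}^H]$ (recall $E[\mathbf n]=\mathbf 0$). Estimators are affine: $\hat{\mathbf x}=\mathbf{E}\mathbf{y}+\mathbf{f}$ with a matrix $\mathbf{E}\in\mathbb{C}^{N_{\mathbf x}\times N_{\mathbf y}}$ and a vector $\mathbf{f}\in\mathbb{C}^{N_{\mathbf x}}$ that do not depend on the unknown $\mathbf{x}$. Two requirements are imposed: (i) unbiasedness on the constraint set: $E_{\mathbf y}[\hat{\mathbf x}]=\mathbf{E}\mathbf{H}\mathbf{x}+\mathbf{f}=\mathbf{x}$ for every $\mathbf{x}\in\mathbb{C}^{N_{\mathbf x}}$ with $\mathbf{A}\mathbf{x}=\mathbf{b}$; (ii) the estimates fulfill the linear constraints: $\mathbf{A}\hat{\mathbf x}=\mathbf{b}$, i.e. $\mathbf{A}(\mathbf{E}\mathbf{y}+\mathbf{f})=\mathbf{b}$ for every $\mathbf{y}$. The constrained best linear unbiased estimator (constrained BLUE) $\hat{\mathbf x}_{\mathrm{CB}}$ is the affine estimator satisfying (i) and (ii) which, for each $i\in\{1,\dots,N_{\mathbf x}\}$, minimizes the variance of the $i$-th element, $E_{\mathbf y}\left[\left|\hat x_i-E_{\mathbf y}[\hat x_i]\right|^2\right]$, among all affine estimators satisfying (i) and (ii). (If $\mathbf{e}_i^H$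 denotes the $i$-th row of $\mathbf{E}$, this variance equals $\mathbf{e}_i^H\mathbf{C}_{\mathbf{nn}}\mathbf{e}_i$.) The covariance matrix of the estimator is $\mathbf{C}_{\hat{\mathbf x}\hat{\mathbf x},\mathrm{CB}}=E_{\mathbf y}\left[(\hat{\mathbf x}_{\mathrm{CB}}-E_{\mathbf y}[\hat{\mathbf x}_{\mathrm{CB}}])(\hat{\mathbf x}_{\mathrm{CB}}-E_{\mathbf y}[\hat{\mathbf x}_{\mathrm{CB}}])^H\right]$. *)

(* Defs.v *)
From mathcomp Require Import all_boot all_order all_algebra spectral.
From mathcomp Require Import all_classical all_reals all_analysis.
From mathcomp Require Import complex.

Set Implicit Arguments.
Unset Strict Implicit.
Unset Printing Implicit Defensive.

Import Order.TTheory GRing.Theory Num.Theory.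

Local Open Scope ring_scope.
Local Open Scope complex_scope.
Local Open Scope sesquilinear_scope.

(* The strict order of R[i] forces the quadratic form to be real. *)
Definition posdefmx (R : realType) (n : nat) (C : 'M[R[i]]_n) : Prop :=
  C \is hermsymmx /\
  forall v : 'cV[R[i]]_n, v != 0 -> 0 < (v^t* *m C *m v) 0 0.

Definition null_basis (R : realType) (m n k : nat)
    (A : 'M[R[i]]_(m, n)) (N : 'M[R[i]]_(n, k)) : Prop :=
  \rank N = k /\
  forall v : 'cV[R[i]]_n, A *m v = 0 <-> exists z : 'cV[R[i]]_k, v = N *m z.

Section Moments.
Context (d : measure_display) (T : measurableType d) (R : realType).
Context (P : probability T R).

(* The library has no measurable structure on R[i], so complex random variables
   are handled through their real and imaginary parts.  [fine] only matters when
   a part is not integrable, in which case the value is meaningless. *)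
Definition cexpectation (Z : T -> R[i]) : R[i] :=
  fine (expectation P (fun w => complex.Re (Z w)))
    +i* fine (expectation P (fun w => complex.Im (Z w))).

Definition mxexpectation (m n : nat) (M : T -> 'M[R[i]]_(m, n)) :
    'M[R[i]]_(m, n) :=
  \matrix_(i, j) cexpectation (fun w => M w i j).

(* Measurable complex random vector whose entries have finite second moments;
   [Lfun] includes measurability. *)
Definition sqintegrable (m : nat) (X : T -> 'cV[R[i]]_m) : Prop :=
  forall i, (fun w => complex.Re (X w i 0)) \in Lfun P 2%:E /\
            (fun w => complex.Im (X w i 0)) \in Lfun P 2%:E.

(* Computed in R[i], where [<=] between two such (real) values is the order
   of R. *)
Definition cvariance (Z : T -> R[i]) : R[i] :=
  cexpectation (fun w => `|Z w - cexpectation Z| ^+ 2).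

Definition covariance_mx (m : nat) (X : T -> 'cV[R[i]]_m) : 'M[R[i]]_m :=
  let mu := mxexpectation X in
  mxexpectation (fun w => (X w - mu) *m (X w - mu)^t*).

End Moments.

Section LinearModel.
Context (d : measure_display) (T : measurableType d) (R : realType).
Context (P : probability T R) (Ny Nx Nb : nat).
Context (H : 'M[R[i]]_(Ny, Nx)) (n : T -> 'cV[R[i]]_Ny).
Context (A : 'M[R[i]]_(Nb, Nx)) (b : 'cV[R[i]]_Nb).

Definition measurement (x : 'cV[R[i]]_Nx) : T -> 'cV[R[i]]_Ny :=
  fun w => H *m x + n w.

Definition affine_estimator (xhat : 'cV[R[i]]_Ny -> 'cV[R[i]]_Nx) : Prop :=
  exists (E : 'M[R[i]]_(Nx, Ny)) (f : 'cV[R[i]]_Nx),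
    forall y, xhat y = E *m y + f.

Definition unbiased_on_constraint (xhat : 'cV[R[i]]_Ny -> 'cV[R[i]]_Nx) : Prop :=
  forall x, A *m x = b ->
    mxexpectation P (fun w => xhat (measurement x w)) = x.

Definition fulfills_constraint (xhat : 'cV[R[i]]_Ny -> 'cV[R[i]]_Nx) : Prop :=
  forall y, A *m xhat y = b.

Definition admissible (xhat : 'cV[R[i]]_Ny -> 'cV[R[i]]_Nx) : Prop :=
  [/\ affine_estimator xhat, unbiased_on_constraint xhat
    & fulfills_constraint xhat].

(* [x] is the true parameter vector: it determines the distribution of the
   measurement under which the variances are taken. *)
Definition constrained_BLUE (x : 'cV[R[i]]_Nx)
    (xhat : 'cV[R[i]]_Ny -> 'cV[R[i]]_Nx) : Prop :=
  admissible xhat /\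
  forall xhat', admissible xhat' -> forall i : 'I_Nx,
    cvariance P (fun w => xhat (measurement x w) i 0)
      <= cvariance P (fun w => xhat' (measurement x w) i 0).

End LinearModel.

(* Main.v *)
Require Import Defs.
From mathcomp Require Import all_boot all_order all_algebra spectral.
From mathcomp Require Import all_classical all_reals all_analysis.
From mathcomp Require Import complex.

Set Implicit Arguments.
Unset Strict Implicit.
Unset Printing Implicit Defensive.

Import Order.TTheory GRing.Theory Num.Theory.

Local Open Scope ring_scope.
Local Open Scope complex_scope.
Local Open Scope sesquilinear_scope.

(** The theorem is the Gauss-Markov principle in an affine setting.  With
    [y = H x + n] and [E[n] = 0], the estimator [E y + f] has mean
    [E H x + f] and covariance matrix [E Cnn E^t*], whatever the distribution
    of [n] ([mean_affine_estimate], [covariance_affine_estimate]), so that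
    admissibility and variances become statements about [E] and [f] only
    ([admissible_affine]).

    If [E0 y + f0] and [E y + f] are both admissible, then [D = E - E0]
    satisfies [D H v = 0] for every [v] in the null space of [A].  Hence, as
    soon as [E0 Cnn D^t* = 0] for all matrices [D] with that property, the
    cross terms vanish and Pythagoras' identity
    [E Cnn E^t* = E0 Cnn E0^t* + D Cnn D^t*] holds.  The last term has a
    nonnegative diagonal, and since [Cnn] is positive definite its diagonal
    vanishes only for [D = 0]: the estimator [E0 y + f0] is the unique
    constrained BLUE ([orthogonal_BLUE]).

    In both cases of the theorem [E0 = Q H^t* Cnn^-1], so that
    [E0 Cnn D^t* = Q (D H)^t*], and only the form of [Q] differs.
    - If [H] has full column rank, [Q = (1 - L A) G^-1] with [A L = 1].  As
      [1 - L A] maps into the null space of [A], one gets [D H = D H L A];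
      then [Q (D H)^t*] ends up as a multiple of [Q A^t*], which is zero by
      the choice of [L].
    - If [N] is a basis of the null space of [A], [Q = N K^-1 N^t*], and
      [N^t* (D H)^t* = (D H N)^t* = 0].
    The matrices [G] and [K] to be inverted are positive definite because they
    are congruent, by matrices of full column rank, to positive definite ones
    ([posdefmx_congr]). *)

(** * Positive definite Hermitian matrices *)

Lemma trmxC_mul (C : numClosedFieldType) (m n p : nat)
    (A : 'M[C]_(m, n)) (B : 'M[C]_(n, p)) :
  (A *m B)^t* = B^t* *m A^t*.
Proof. by rewrite trmx_mul map_mxM. Qed.

Lemma trmxC_inv (C : numClosedFieldType) (n : nat) (A : 'M[C]_n) :
  (invmx A)^t* = invmx (A^t*).
Proof. by rewrite trmx_inv map_invmx. Qed.

Lemma mxrank_trmxC (C : numClosedFieldType) (m n : nat) (A : 'M[C]_(m, n)) :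
  \rank (A^t*) = \rank A.
Proof. by rewrite mxrank_map mxrank_tr. Qed.

Lemma full_col_rank_eq0 (F : fieldType) (m n p : nat)
    (A : 'M[F]_(m, n)) (B : 'M[F]_(n, p)) :
  \rank A = n -> A *m B = 0 -> B = 0.
Proof.
move=> rA /(congr1 trmx); rewrite trmx_mul trmx0 => /eqP.
rewrite mulmx_free_eq0 /row_free ?mxrank_tr ?rA// => /eqP /(congr1 trmx).
by rewrite trmxK trmx0.
Qed.

Section PositiveDefinite.
Context (R : realType).

Lemma posdefmx_herm (n : nat) (C : 'M[R[i]]_n) : posdefmx C -> C^t* = C.
Proof. by case=> /is_hermitianmxP; rewrite expr0 scale1r => <-. Qed.

Lemma posdefmx_unit (n : nat) (C : 'M[R[i]]_n) : posdefmx C -> C \in unitmx.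
Proof.
case=> _ Cpos; rewrite -row_free_unit; apply: inj_row_free => v vC0.
apply/eqP; apply: contraT => v0.
have vt0 : v^t* != 0.
  apply: contra_neq v0 => /(congr1 (fun u => u^t*)).
  by rewrite trmxCK trmx0 map_mx0.
by have := Cpos _ vt0; rewrite trmxCK vC0 mul0mx mxE ltxx.
Qed.

Lemma posdefmx_congr (n k : nat) (C : 'M[R[i]]_n) (M : 'M[R[i]]_(n, k)) :
  posdefmx C -> \rank M = k -> posdefmx (M^t* *m C *m M).
Proof.
move=> pC rM; have [_ Cpos] := pC; split.
  by apply/is_hermitianmxP; rewrite expr0 scale1r !trmxC_mul trmxCK
    (posdefmx_herm pC) mulmxA.
move=> v v0.
have Mv0 : M *m v != 0 by apply: contra_neq v0; exact: full_col_rank_eq0.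
by have := Cpos _ Mv0; rewrite trmxC_mul !mulmxA.
Qed.

(** The inverse is congruent to [C], by the Hermitian matrix [invmx C]. *)
Lemma posdefmx_inv (n : nat) (C : 'M[R[i]]_n) :
  posdefmx C -> posdefmx (invmx C).
Proof.
move=> pC; have uC := posdefmx_unit pC.
have -> : invmx C = (invmx C)^t* *m C *m invmx C.
  by rewrite trmxC_inv (posdefmx_herm pC) mulVmx// mul1mx.
by apply: posdefmx_congr => //; apply: mxrank_unit; rewrite unitmx_inv.
Qed.

(** Each diagonal entry is the value of the quadratic form at the conjugate of
    a row of [D].  The equality case gives the uniqueness of the BLUE. *)
Lemma posdefmx_diag (m n : nat) (C : 'M[R[i]]_n) (D : 'M[R[i]]_(m, n)) i :
  posdefmx C -> 0 <= (D *m C *m D^t*) i i ?= iff (row i D == 0).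
Proof.
move=> [_ Cpos].
have -> : (D *m C *m D^t*) i i =
    (((row i D)^t*)^t* *m C *m (row i D)^t*) 0 0.
  rewrite trmxCK -row_mul !mxE; apply: eq_bigr => k _.
  by rewrite !mxE.
have [->|r0] := eqVneq (row i D) 0.
  by rewrite trmxCK !mul0mx mxE; apply/leifP.
apply/leifP; apply: Cpos; apply: contra_neq r0 => /(congr1 (fun u => u^t*)).
by rewrite trmxCK trmx0 map_mx0.
Qed.

End PositiveDefinite.

(** * Expectation of complex random matrices *)

Section ComplexExpectation.
Context (d : measure_display) (T : measurableType d) (R : realType).
Context (P : probability T R).

Lemma eq_Lfun1 (X Y : T -> R) :
  Y \in Lfun P 1%E -> X =1 Y -> X \in Lfun P 1%E.
Proof. by move=> + /funext ->. Qed.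

Lemma Lfun1_lincomb (X Y : T -> R) (a b : R) :
  X \in Lfun P 1%E -> Y \in Lfun P 1%E ->
  (fun w => a * X w + b * Y w) \in Lfun P 1%E.
Proof.
move=> X1 Y1.
have -> : (fun w => a * X w + b * Y w) = (a *: X) \+ (b *: Y) by [].
have [c0 cl] := @Lfun_submod_closed _ _ _ P 1%E (lexx _).
apply: (cl a X (b *: Y)) => //.
by rewrite -[b *: Y]addr0; apply: cl.
Qed.

Lemma expectation_lincomb (X Y : T -> R) (a b : R) :
  X \in Lfun P 1%E -> Y \in Lfun P 1%E ->
  fine (expectation P (fun w => a * X w + b * Y w)) =
  a * fine (expectation P X) + b * fine (expectation P Y).
Proof.
move=> X1 Y1.
have aX : (a \o* X) \in Lfun P 1%E.
  apply: (eq_Lfun1 (Lfun1_lincomb a 0 X1 X1)) => w.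
  by rewrite /= mul0r addr0 mulrC.
have bY : (b \o* Y) \in Lfun P 1%E.
  apply: (eq_Lfun1 (Lfun1_lincomb b 0 Y1 Y1)) => w.
  by rewrite /= mul0r addr0 mulrC.
have -> : (fun w => a * X w + b * Y w) = (a \o* X) \+ (b \o* Y).
  by apply/funext => w /=; rewrite [a * _]mulrC [b * _]mulrC.
rewrite expectationD// !expectationZl// fineD ?fineM// ?fin_numM//;
  by rewrite ?expectation_fin_num.
Qed.

Definition cintegrable (Z : T -> R[i]) : Prop :=
  (fun w => complex.Re (Z w)) \in Lfun P 1%E /\
  (fun w => complex.Im (Z w)) \in Lfun P 1%E.

Lemma cintegrable_cst (c : R[i]) : cintegrable (fun=> c).
Proof. by split; exact: (Lfun_cst P _ 1). Qed.

Lemma cexpectation_cst (c : R[i]) : cexpectation P (fun=> c) = c.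
Proof. by rewrite /cexpectation !expectation_cst /=; case: c. Qed.

(** One complex multiply-and-add carries both additivity and homogeneity, and
    is the step of the induction over finite linear combinations. *)
Lemma cintegrableMD (c : R[i]) (Z W : T -> R[i]) :
  cintegrable Z -> cintegrable W -> cintegrable (fun w => c * Z w + W w).
Proof.
move=> [Zr Zi] [Wr Wi]; split.
  apply: (eq_Lfun1 (Lfun1_lincomb 1 1
    (Lfun1_lincomb (complex.Re c) (- complex.Im c) Zr Zi) Wr)) => w.
  by case: c (Z w) (W w) => [a b] [z1 z2] [w1 w2] /=; rewrite !mul1r mulNr.
apply: (eq_Lfun1 (Lfun1_lincomb 1 1
    (Lfun1_lincomb (complex.Im c) (complex.Re c) Zr Zi) Wi)) => w.
case: c (Z w) (W w) => [a b] [z1 z2] [w1 w2] /=; rewrite !mul1r.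
by rewrite [X in X + _]addrC.
Qed.

Lemma cexpectationMD (c : R[i]) (Z W : T -> R[i]) :
  cintegrable Z -> cintegrable W ->
  cexpectation P (fun w => c * Z w + W w) =
  c * cexpectation P Z + cexpectation P W.
Proof.
move=> [Zr Zi] [Wr Wi]; rewrite /cexpectation.
have -> : (fun w => complex.Re (c * Z w + W w)) = (fun w =>
    1 * (complex.Re c * complex.Re (Z w) + - complex.Im c * complex.Im (Z w))
    + 1 * complex.Re (W w)).
  apply/funext => w.
  by case: c (Z w) (W w) => [a b] [z1 z2] [w1 w2] /=; rewrite !mul1r mulNr.
have -> : (fun w => complex.Im (c * Z w + W w)) = (fun w =>
    1 * (complex.Im c * complex.Re (Z w) + complex.Re c * complex.Im (Z w))
    + 1 * complex.Im (W w)).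
  apply/funext => w.
  case: c (Z w) (W w) => [a b] [z1 z2] [w1 w2] /=; rewrite !mul1r.
  by rewrite [X in X + _]addrC.
rewrite !expectation_lincomb ?Lfun1_lincomb// !mul1r.
case: c => a b; apply/eqP; rewrite eq_complex /= mulNr eqxx /=.
by rewrite [X in X + _ == _]addrC.
Qed.

Lemma cexpectation_lincomb (I : Type) (s : seq I) (c : I -> R[i])
    (Z : I -> T -> R[i]) :
  (forall j, cintegrable (Z j)) ->
  cintegrable (fun w => \sum_(j <- s) c j * Z j w) /\
  cexpectation P (fun w => \sum_(j <- s) c j * Z j w) =
    \sum_(j <- s) c j * cexpectation P (Z j).
Proof.
move=> Zi; elim: s => [|j s [IHi IHe]].
  under eq_fun do rewrite big_nil.
  by rewrite big_nil; split; [exact: cintegrable_cst|exact: cexpectation_cst].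
under eq_fun do rewrite big_cons.
by rewrite big_cons cexpectationMD// IHe; split=> //; exact: cintegrableMD.
Qed.

Definition mxintegrable (m n : nat) (M : T -> 'M[R[i]]_(m, n)) : Prop :=
  forall i j, cintegrable (fun w => M w i j).

Lemma mxexpectation_mull (m n p : nat) (E : 'M[R[i]]_(m, n))
    (M : T -> 'M[R[i]]_(n, p)) :
  mxintegrable M ->
  mxintegrable (fun w => E *m M w) /\
  mxexpectation P (fun w => E *m M w) = E *m mxexpectation P M.
Proof.
move=> Mi; split=> [i j|]; last apply/matrixP => i j; rewrite ?mxE.
  under eq_fun do rewrite mxE.
  by have [] := @cexpectation_lincomb _ (index_enum _) (E i)
    (fun k w => M w k j) (fun k => Mi k j).
under eq_fun do rewrite mxE.
have [_ ->] := @cexpectation_lincomb _ (index_enum _) (E i)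
    (fun k w => M w k j) (fun k => Mi k j).
by apply: eq_bigr => k _; rewrite !mxE.
Qed.

Lemma mxexpectation_tr (m n : nat) (M : T -> 'M[R[i]]_(m, n)) :
  mxexpectation P (fun w => (M w)^T) = (mxexpectation P M)^T.
Proof.
by apply/matrixP => i j; rewrite !mxE; under eq_fun do rewrite mxE.
Qed.

Lemma mxexpectation_mulr (m n p : nat) (M : T -> 'M[R[i]]_(m, n))
    (F : 'M[R[i]]_(n, p)) :
  mxintegrable M ->
  mxexpectation P (fun w => M w *m F) = mxexpectation P M *m F.
Proof.
move=> Mi; apply: trmx_inj; rewrite -mxexpectation_tr trmx_mul.
under eq_fun do rewrite trmx_mul.
rewrite -mxexpectation_tr.
have [//|_ ->//] := @mxexpectation_mull _ _ _ F^T (fun w => (M w)^T).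
by move=> i j; under eq_fun do rewrite mxE; exact: Mi.
Qed.

Lemma mxexpectationDcst (m n : nat) (M : T -> 'M[R[i]]_(m, n))
    (B : 'M[R[i]]_(m, n)) :
  mxintegrable M ->
  mxexpectation P (fun w => M w + B) = mxexpectation P M + B.
Proof.
move=> Mi; apply/matrixP => i j; rewrite !mxE.
have := cexpectationMD 1 (Mi i j) (cintegrable_cst (B i j)).
rewrite cexpectation_cst mul1r => <-; congr cexpectation.
by apply/funext => w; rewrite mxE mul1r.
Qed.

Lemma sqintegrable_mxintegrable (m : nat) (X : T -> 'cV[R[i]]_m) :
  sqintegrable P X -> mxintegrable X.
Proof.
move=> X2 i j; rewrite (ord1 j); have [Xr Xi] := X2 i.
by split; apply: Lfun_subset12; rewrite ?fin_num_measure.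
Qed.

(** The real and imaginary parts of [X_i * conj X_j] are combinations of
    products of two real square integrable functions, integrable by the
    Cauchy-Schwarz inequality. *)
Lemma sqintegrable_outer (m : nat) (X : T -> 'cV[R[i]]_m) :
  sqintegrable P X -> mxintegrable (fun w => X w *m (X w)^t*).
Proof.
move=> X2 i j.
have [Xir Xii] := X2 i; have [Xjr Xji] := X2 j.
have E w : (X w *m (X w)^t*) i j = X w i 0 * (X w j 0)^*%C.
  by rewrite mxE big_ord1 !mxE.
split.
  apply: (eq_Lfun1 (Lfun1_lincomb 1 1
    (Lfun2_mul_Lfun1 Xir Xjr) (Lfun2_mul_Lfun1 Xii Xji))) => w.
  rewrite E /=; case: (X w i 0) (X w j 0) => [a b] [a' b'] /=.
  by rewrite !mul1r mulrN opprK.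
apply: (eq_Lfun1 (Lfun1_lincomb 1 (-1)
    (Lfun2_mul_Lfun1 Xii Xjr) (Lfun2_mul_Lfun1 Xir Xji))) => w.
rewrite E /=; case: (X w i 0) (X w j 0) => [a b] [a' b'] /=.
by rewrite mul1r mulN1r mulrN addrC.
Qed.

(** Centring removes [f] and leaves the vector [E X], whose outer product with
    itself is [X X^t*] multiplied by [E] and by [E^t*] on its two sides. *)
Lemma covariance_affine (m k : nat) (X : T -> 'cV[R[i]]_m)
    (E : 'M[R[i]]_(k, m)) (f : 'cV[R[i]]_k) :
  sqintegrable P X -> mxexpectation P X = 0 ->
  covariance_mx P (fun w => E *m X w + f) =
    E *m mxexpectation P (fun w => X w *m (X w)^t*) *m E^t*.
Proof.
move=> X2 X0; have Xi := sqintegrable_mxintegrable X2.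
have [EXi EXe] := mxexpectation_mull E Xi.
rewrite /covariance_mx mxexpectationDcst// EXe X0 mulmx0 add0r.
have Oi := sqintegrable_outer X2.
have [EOi <-] := mxexpectation_mull E Oi.
rewrite -mxexpectation_mulr//; congr mxexpectation; apply/funext => w.
by rewrite addrK trmxC_mul !mulmxA.
Qed.

(** Since [`|z| ^+ 2 = z * conj z], both sides are expectations of the same
    random variable. *)
Lemma cvariance_covariance_mx (m : nat) (X : T -> 'cV[R[i]]_m) (i : 'I_m) :
  cvariance P (fun w => X w i 0) = covariance_mx P X i i.
Proof.
rewrite /cvariance mxE; congr cexpectation; apply/funext => w.
by rewrite normCK mxE big_ord1 !mxE.
Qed.

End ComplexExpectation.

(** * The optimality criterion *)

Section Optimality.
Context (d : measure_display) (T : measurableType d) (R : realType).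
Context (P : probability T R) (Ny Nx Nb : nat).
Context (H : 'M[R[i]]_(Ny, Nx)) (n : T -> 'cV[R[i]]_Ny).
Context (A : 'M[R[i]]_(Nb, Nx)) (b : 'cV[R[i]]_Nb).
Context (Cnn : 'M[R[i]]_Ny).
Hypothesis n_L2 : sqintegrable P n.
Hypothesis n_mean0 : mxexpectation P n = 0.
Hypothesis n_cov : Cnn = mxexpectation P (fun w => n w *m (n w)^t*).

Let estimateE (E : 'M[R[i]]_(Nx, Ny)) (f x : 'cV[R[i]]_Nx) :
  (fun w => E *m measurement H n x w + f) =
  (fun w => E *m n w + (E *m H *m x + f)).
Proof.
by apply/funext => w; rewrite /measurement mulmxDr mulmxA addrAC addrC.
Qed.

Lemma mean_affine_estimate (E : 'M[R[i]]_(Nx, Ny)) (f x : 'cV[R[i]]_Nx) :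
  mxexpectation P (fun w => E *m measurement H n x w + f) = E *m H *m x + f.
Proof.
have ni := sqintegrable_mxintegrable n_L2.
have [Eni EnE] := mxexpectation_mull E ni.
by rewrite estimateE mxexpectationDcst// EnE n_mean0 mulmx0 add0r.
Qed.

Lemma covariance_affine_estimate (E : 'M[R[i]]_(Nx, Ny)) (f x : 'cV[R[i]]_Nx) :
  covariance_mx P (fun w => E *m measurement H n x w + f) = E *m Cnn *m E^t*.
Proof. by rewrite estimateE covariance_affine// -n_cov. Qed.

(** The constraint [A (E y + f) = b] for all [y] splits into its linear and
    constant parts, seen at [y = 0] and at the basis vectors. *)
Lemma admissible_affine (E : 'M[R[i]]_(Nx, Ny)) (f : 'cV[R[i]]_Nx) :
  admissible P H n A b (fun y => E *m y + f) <->
  [/\ forall x, A *m x = b -> E *m H *m x + f = x, A *m E = 0 & A *m f = b].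
Proof.
split=> [[_ unb cst]|[unb AE Af]].
  have Af : A *m f = b by have := cst 0; rewrite mulmx0 add0r.
  split=> // [x Ax|]; first by rewrite -(mean_affine_estimate E) unb.
  apply/matrixP => i j.
  have := cst (delta_mx j 0); rewrite mulmxDr Af => /eqP.
  rewrite -subr_eq0 addrK mulmxA -colE => /eqP /matrixP /(_ i 0).
  by rewrite !mxE.
split; first by exists E, f.
  by move=> x Ax; rewrite mean_affine_estimate unb.
by move=> y; rewrite mulmxDr mulmxA AE mul0mx add0r.
Qed.

Hypothesis Cnn_posdef : posdefmx Cnn.
Context (x : 'cV[R[i]]_Nx).
Hypothesis x_constr : A *m x = b.

(** The orthogonality principle.  The linear parts of two admissible estimators
    differ by a matrix [D] such that [D H] vanishes on the null space of [A].
    If the error [E0 n] is uncorrelated with [D n] for all such [D], leaving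
    [E0] only adds the covariance matrix of [D n].  The condition on [D] uses
    matrices [V] rather than vectors, to be instantiated with a projector onto
    the null space of [A] or with a basis of it. *)
Lemma orthogonal_BLUE (E0 : 'M[R[i]]_(Nx, Ny)) (f0 : 'cV[R[i]]_Nx) :
  admissible P H n A b (fun y => E0 *m y + f0) ->
  (forall D : 'M[R[i]]_(Nx, Ny),
     (forall (k : nat) (V : 'M[R[i]]_(Nx, k)),
        A *m V = 0 -> D *m H *m V = 0) ->
     E0 *m Cnn *m D^t* = 0) ->
  (forall xhat, constrained_BLUE P H n A b x xhat <->
     forall y, xhat y = E0 *m y + f0) /\
  (forall xhat, constrained_BLUE P H n A b x xhat ->
     covariance_mx P (fun w => xhat (measurement H n x w)) =
       E0 *m Cnn *m E0^t*).
Proof.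
move=> adm0 orth.
have [unb0 _ _] := (admissible_affine _ _).1 adm0.
have key (E : 'M[R[i]]_(Nx, Ny)) (f : 'cV[R[i]]_Nx) :
    admissible P H n A b (fun y => E *m y + f) ->
    (E - E0) *m H *m x + (f - f0) = 0 /\
    E *m Cnn *m E^t* =
      E0 *m Cnn *m E0^t* + (E - E0) *m Cnn *m (E - E0)^t*.
  move=> /admissible_affine[unb _ _].
  (* both estimators are unbiased on the constraint set *)
  have diff u : A *m u = b -> (E - E0) *m H *m u + (f - f0) = 0.
    by move=> Au; rewrite !mulmxBl addrACA -opprD unb// unb0// subrr.
  split; first exact: diff.
  set D := E - E0.
  have ED : E0 *m Cnn *m D^t* = 0.
    apply: orth => k V AV.
    apply/matrixP => r j; rewrite [RHS]mxE.
    have Av : A *m col j V = 0 by rewrite colE mulmxA AV mul0mx.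
    suff /matrixP/(_ r 0) : D *m H *m col j V = 0.
      by rewrite colE mulmxA -colE !mxE.
    have := diff (x + col j V); rewrite mulmxDr x_constr Av addr0 => /(_ erefl).
    by rewrite mulmxDr addrAC (diff x x_constr) add0r.
  have DE : D *m Cnn *m E0^t* = 0.
    have := congr1 (fun M => M^t*) ED.
    by rewrite !trmxC_mul trmxCK (posdefmx_herm Cnn_posdef) trmx0 map_mx0
      mulmxA.
  have -> : E = E0 + D by rewrite addrC subrK.
  rewrite linearD /= map_mxD 2!mulmxDl !mulmxDr.
  by rewrite ED DE addr0 add0r.
have var (E : 'M[R[i]]_(Nx, Ny)) (f : 'cV[R[i]]_Nx) (i : 'I_Nx) :
    cvariance P (fun w => (E *m measurement H n x w + f) i 0) =
    (E *m Cnn *m E^t*) i i.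
  by rewrite -(covariance_affine_estimate E f x) -cvariance_covariance_mx.
have charac xhat : constrained_BLUE P H n A b x xhat <->
    forall y, xhat y = E0 *m y + f0.
  split=> [[adm opt]|/funext ->].
    have [[E [f /funext xhatE]] _ _] := adm.
    rewrite {}xhatE in adm opt *.
    have [diff cov] := key _ _ adm.
    have D0 : E - E0 = 0.
      apply/row_matrixP => i; rewrite row0.
      (* optimality of E against E0 forces the extra term D Cnn D^t* of cov to
         have a nonpositive diagonal *)
      have := opt _ adm0 i; rewrite !var cov mxE gerDl => le0.
      have [ge0 eq0] := posdefmx_diag (E - E0) i Cnn_posdef.
      by apply/eqP; rewrite -eq0 eq_le ge0 le0.
    (* with equal linear parts, unbiasedness at x forces equal constants *)
    move: diff; rewrite D0 !mul0mx add0r => /eqP; rewrite subr_eq0 => /eqP ->.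
    by move/eqP: D0; rewrite subr_eq0 => /eqP ->.
  split=> // xhat' adm i.
  have [[E [f /funext xhatE]] _ _] := adm.
  rewrite {}xhatE in adm *.
  have [_ cov] := key _ _ adm.
  rewrite !var cov [leRHS]mxE lerDl.
  exact: (posdefmx_diag (E - E0) i Cnn_posdef).1.
split=> // xhat /charac /funext ->; exact: covariance_affine_estimate.
Qed.

End Optimality.

(** * The constrained BLUE *)

Theorem mainTheorem1
  (d : measure_display) (T : measurableType d) (R : realType)
  (P : probability T R) (Ny Nx Nb : nat)
  (Ny_gt0 : (0 < Ny)%N) (Nx_gt0 : (0 < Nx)%N) (Nb_gt0 : (0 < Nb)%N)
  (Nb_lt : (Nb < Nx)%N)
  (H : 'M[R[i]]_(Ny, Nx)) (x : 'cV[R[i]]_Nx) (n : T -> 'cV[R[i]]_Ny)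
  (Cnn : 'M[R[i]]_Ny) (A : 'M[R[i]]_(Nb, Nx)) (b : 'cV[R[i]]_Nb)
  (n_L2 : sqintegrable P n)
  (n_mean0 : mxexpectation P n = 0)
  (n_cov : Cnn = mxexpectation P (fun w => n w *m (n w)^t*))
  (Cnn_posdef : posdefmx Cnn)
  (A_full : \rank A = Nb)
  (x_constr : A *m x = b) :
  let G := H^t* *m invmx Cnn *m H in
  ((Nx <= Ny)%N -> \rank H = Nx ->
    let K := A *m invmx G *m A^t* in
    let L := invmx G *m A^t* *m invmx K in
    [/\ G \in unitmx,
        K \in unitmx,
        forall xhat : 'cV[R[i]]_Ny -> 'cV[R[i]]_Nx,
          constrained_BLUE P H n A b x xhat <->
          forall y, xhat y =
            (1%:M - L *m A) *m invmx G *m H^t* *m invmx Cnn *m y + L *m b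
      & forall xhat : 'cV[R[i]]_Ny -> 'cV[R[i]]_Nx,
          constrained_BLUE P H n A b x xhat ->
          covariance_mx P (fun w => xhat (measurement H n x w)) =
            invmx G - L *m A *m invmx G])
  /\
  (~~ (Nx <= Ny)%N ->
    forall N : 'M[R[i]]_(Nx, Nx - Nb),
    null_basis A N ->
    \rank (H *m N) = (Nx - Nb)%N ->
    let K := N^t* *m G *m N in
    [/\ (Nx - Nb <= Ny)%N,
        K \in unitmx,
        forall xp : 'cV[R[i]]_Nx, A *m xp = b ->
        forall xhat : 'cV[R[i]]_Ny -> 'cV[R[i]]_Nx,
          constrained_BLUE P H n A b x xhat <->
          forall y, xhat y =
            N *m invmx K *m N^t* *m H^t* *m invmx Cnn *m (y - H *m xp) + xp
      & forall xhat : 'cV[R[i]]_Ny -> 'cV[R[i]]_Nx,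
          constrained_BLUE P H n A b x xhat ->
          covariance_mx P (fun w => xhat (measurement H n x w)) =
            N *m invmx K *m N^t*]).
Proof.
move=> G; set S := invmx Cnn.
have pS : posdefmx S := posdefmx_inv Cnn_posdef.
have SC : S *m Cnn = 1%:M by rewrite mulVmx// posdefmx_unit.
have Sh : S^t* = S := posdefmx_herm pS.
split=> [Nx_le rH K L|_ N [rN kerA] rHN K].
  have pG : posdefmx G by exact: posdefmx_congr.
  have uG := posdefmx_unit pG.
  have pK : posdefmx K.
    rewrite /K -{1}(trmxCK A); apply: posdefmx_congr; first exact: posdefmx_inv.
    by rewrite mxrank_trmxC.
  have uK := posdefmx_unit pK.
  have AL : A *m L = 1%:M by rewrite /L !mulmxA mulmxV.
  (* 1 - L A is a projector onto the null space of A *)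
  have ALA : A *m (1%:M - L *m A) = 0.
    by rewrite mulmxBr mulmx1 mulmxA AL mul1mx subrr.
  set Q := (1%:M - L *m A) *m invmx G.
  have QA : Q *m A^t* = 0.
    by rewrite /Q -mulmxA mulmxBl mul1mx /L -!mulmxA [A *m _]mulmxA -/K
      mulVmx// mulmx1 subrr.
  have QH : Q *m H^t* *m S *m Cnn = Q *m H^t*.
    by rewrite -mulmxA SC mulmx1.
  have Gih : (invmx G)^t* = invmx G by rewrite trmxC_inv (posdefmx_herm pG).
  have QG : Q *m H^t* *m S *m H = 1%:M - L *m A.
    by rewrite -!mulmxA [H^t* *m _]mulmxA -/G mulVmx// mulmx1.
  have adm : admissible P H n A b (fun y => Q *m H^t* *m S *m y + L *m b).
    apply/admissible_affine => //; split=> [u Au||].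
    - by rewrite QG mulmxBl mul1mx -mulmxA Au subrK.
    - by rewrite /Q !mulmxA ALA !mul0mx.
    - by rewrite mulmxA AL mul1mx.
  have orth (D : 'M[R[i]]_(Nx, Ny)) :
      (forall (k : nat) (V : 'M[R[i]]_(Nx, k)),
         A *m V = 0 -> D *m H *m V = 0) ->
      Q *m H^t* *m S *m Cnn *m D^t* = 0.
    move=> Dker.
    have DH : D *m H = D *m H *m L *m A.
      have /eqP := Dker _ _ ALA.
      by rewrite mulmxBr mulmx1 mulmxA subr_eq0 => /eqP.
    rewrite QH -mulmxA -trmxC_mul DH trmxC_mul.
    by rewrite mulmxA QA mul0mx.
  have [charac cov] :=
    orthogonal_BLUE n_L2 n_mean0 n_cov Cnn_posdef x_constr adm orth.
  split=> // xhat /cov ->.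
  rewrite QH 2!trmxC_mul trmxCK Sh !mulmxA QG.
  have -> : Q^t* = invmx G *m (1%:M - A^t* *m L^t*).
    by rewrite trmxC_mul Gih linearB /= map_mxB trmx1 map_mx1 trmxC_mul.
  by rewrite mulmxA -/Q mulmxBr mulmx1 mulmxA QA mul0mx subr0 /Q mulmxBl mul1mx.
have pK : posdefmx K.
  rewrite /K /G !mulmxA -trmxC_mul -mulmxA; exact: posdefmx_congr.
have uK := posdefmx_unit pK.
have AN : A *m N = 0.
  apply/matrixP => r j; rewrite [RHS]mxE.
  have /kerA/matrixP/(_ r 0) : exists z, col j N = N *m z.
    by exists (delta_mx j 0); exact: colE.
  by rewrite colE mulmxA -colE !mxE.
set Q := N *m invmx K *m N^t*.
have Qh : Q^t* = Q.
  by rewrite !trmxC_mul trmxCK trmxC_inv (posdefmx_herm pK) mulmxA.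
have QGN : Q *m H^t* *m S *m H *m N = N.
  by rewrite -[RHS](mulmxKV uK) /Q /K /G !mulmxA.
have QH : Q *m H^t* *m S *m Cnn = Q *m H^t* by rewrite -mulmxA SC mulmx1.
have orth (D : 'M[R[i]]_(Nx, Ny)) :
    (forall (k : nat) (V : 'M[R[i]]_(Nx, k)), A *m V = 0 -> D *m H *m V = 0) ->
    Q *m H^t* *m S *m Cnn *m D^t* = 0.
  move=> /(_ _ _ AN) DHN.
  by rewrite QH /Q -!mulmxA -!trmxC_mul mulmxA DHN trmx0 map_mx0 !mulmx0.
have adm xp : A *m xp = b ->
    admissible P H n A b
      (fun y => Q *m H^t* *m S *m y + (xp - Q *m H^t* *m S *m H *m xp)).
  move=> Axp; apply/admissible_affine => //; split=> [u Au||].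
  - have /kerA[z uxp] : A *m (u - xp) = 0 by rewrite mulmxBr Au Axp subrr.
    by rewrite addrCA -mulmxBr uxp mulmxA QGN -uxp addrC subrK.
  - by rewrite /Q !mulmxA AN !mul0mx.
  - by rewrite mulmxBr Axp /Q !mulmxA AN !mul0mx subr0.
have BLUE xp (Axp : A *m xp = b) :=
  orthogonal_BLUE n_L2 n_mean0 n_cov Cnn_posdef x_constr (adm xp Axp) orth.
split=> // [|xp Axp xhat|xhat].
- by rewrite -rHN rank_leq_row.
- have affE y : Q *m H^t* *m S *m (y - H *m xp) + xp =
      Q *m H^t* *m S *m y + (xp - Q *m H^t* *m S *m H *m xp).
    by rewrite mulmxBr mulmxA addrAC -addrA.
  by rewrite (BLUE xp Axp).1; split=> xhatE y; rewrite xhatE affE.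
(* Q does not depend on xp; the true parameter is one particular solution *)
move=> /(BLUE x x_constr).2 ->.
by rewrite QH 2!trmxC_mul trmxCK Sh Qh !mulmxA QGN.
Qed.
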